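(* Let $G$ be a $(K_1\cup P_2)$-free graph of order $n$. Then either $G$ is hamiltonian, or $G\in\aleph$ and $\alpha(G)>n/2$.
   Context: All graphs are finite, undirected, without loops or multiple edges, and have at least one vertex. The order $n$ of $G$ is its number of vertices, and $\alpha(G)$ is the independence number (maximum size of an independent set of vertices). $P_i$ denotes the path on $i$ vertices, so $P_2=K_2$ is a single edge; $K_1\cup P_2$ is the disjoint union of a single vertex and an edge. A graph $G$ is $H$-free if no induced subgraph of $G$ is isomorphic to $H$. Cycle convention: a cycle of length $t$ is a sequence $v_1v_2\ldots v_tv_1$ of distinct vertices $v_1,\ldots,v_t$ with $v_iv_{i+1}\in E(G)$ for each $i$ (where $v_{t+1}=v_1$). A single vertex is regarded as a cycle of length 1 and a single edge as a cycle of length 2. A graph of order $n$ is hamiltonian if it contains a cycle of length $n$ (a Hamilton cycle). In particular $K_1$ and $K_2$ count as hamiltonian. $N(v)$ denotes the neighborhood of a vertex $v$ in $G$, and $G[S]$ the subgraph of $G$ induced by $S\subseteq V(G)$. The class $\aleph$ is defined recursively (it is the smallest class satisfying the following): $G\in\aleph$ if and only if either $V(G)$ is an independent set of vertices, or $G$ is a complete graph, or there is a partition of $V(G)$ into two nonempty sets $V(G)=V_1\cup V_2$ such that: 1) $V_1$ is an independent set of vertices; 2) $N(v)=V_2$ for each $v\in V_1$; 3) $G[V_2]\in\aleph$. The ''either ... or'' in the claim is inclusive: at least one of the two alternatives holds. *)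

(* Defs.v *)
(* MathComp *)
From mathcomp Require Import all_boot.

Set Implicit Arguments.
Unset Strict Implicit.
Unset Printing Implicit Defensive.

(* The vertex type may be empty; nonemptiness is a separate hypothesis. *)
Record sgraph := SGraph {
  vertex :> finType;
  adj : rel vertex;
  adj_sym : symmetric adj;
  adj_irrefl : irreflexive adj
}.

Section InducedSubgraph.
Variables (G : sgraph) (S : {set G}).

Definition induced_adj : rel {x : G | x \in S} :=
  fun x y => adj (val x) (val y).

Lemma induced_adj_sym : symmetric induced_adj.
Proof. by move=> x y; apply: adj_sym. Qed.

Lemma induced_adj_irrefl : irreflexive induced_adj.
Proof. by move=> x; apply: adj_irrefl. Qed.

Definition induced : sgraph := SGraph induced_adj_sym induced_adj_irrefl.
End InducedSubgraph.

Definition isomorphic (G H : sgraph) : Prop :=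
  exists f : G -> H, bijective f /\ forall x y, adj (f x) (f y) = adj x y.

Definition free_of (H G : sgraph) : Prop :=
  forall S : {set G}, ~ isomorphic (induced S) H.

Section CompleteGraph.
Variable n : nat.

Definition complete_adj : rel 'I_n := fun i j => i != j.

Lemma complete_adj_sym : symmetric complete_adj.
Proof. by move=> i j; rewrite /complete_adj eq_sym. Qed.

Lemma complete_adj_irrefl : irreflexive complete_adj.
Proof. by move=> i; rewrite /complete_adj eqxx. Qed.

Definition complete_graph : sgraph :=
  SGraph complete_adj_sym complete_adj_irrefl.
End CompleteGraph.

Section PathGraph.
Variable n : nat.

Definition path_adj : rel 'I_n :=
  fun i j => (i.+1 == j :> nat) || (j.+1 == i :> nat).

Lemma path_adj_sym : symmetric path_adj.
Proof. by move=> i j; rewrite /path_adj orbC. Qed.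

Lemma path_adj_irrefl : irreflexive path_adj.
Proof. by move=> i; rewrite /path_adj orbb gtn_eqF. Qed.

Definition path_graph : sgraph := SGraph path_adj_sym path_adj_irrefl.
End PathGraph.

Section DisjointUnion.
Variables G H : sgraph.

Definition disjoint_union_adj : rel (G + H)%type := fun u v =>
  match u, v with
  | inl x, inl y => adj x y
  | inr x, inr y => adj x y
  | _, _ => false
  end.

Lemma disjoint_union_adj_sym : symmetric disjoint_union_adj.
Proof. by case=> x [] y //=; apply: adj_sym. Qed.

Lemma disjoint_union_adj_irrefl : irreflexive disjoint_union_adj.
Proof. by case=> x /=; apply: adj_irrefl. Qed.

Definition disjoint_union : sgraph :=
  SGraph disjoint_union_adj_sym disjoint_union_adj_irrefl.
End DisjointUnion.

Definition neighborhood (G : sgraph) (v : G) : {set G} := [set w | adj v w].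

Definition independent (G : sgraph) (S : {set G}) : bool :=
  [forall x in S, forall y in S, ~~ adj x y].

Definition independence_number (G : sgraph) : nat :=
  \max_(S : {set G} | independent S) #|S|.

Definition is_complete (G : sgraph) : bool :=
  [forall x : G, forall y : G, (x != y) ==> adj x y].

(* A single vertex is a cycle of length 1, although [ucycleb] rejects
   [:: x] for an irreflexive relation; a single edge, as [:: x; y], is
   accepted by [ucycleb] as a cycle of length 2. *)
Definition graph_cycle (G : sgraph) (s : seq G) : bool :=
  (size s == 1) || (s != [::]) && ucycleb (@adj G) s.

Definition hamiltonian (G : sgraph) : Prop :=
  exists2 s : seq G, graph_cycle s & size s = #|G|.

Inductive aleph : sgraph -> Prop :=
| aleph_independent (G : sgraph) : independent [set: G] -> aleph G
| aleph_complete (G : sgraph) : is_complete G -> aleph G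
| aleph_join (G : sgraph) (V1 V2 : {set G}) :
    V1 :|: V2 = [set: G] -> [disjoint V1 & V2] ->
    V1 != set0 -> V2 != set0 ->
    independent V1 ->
    (forall v, v \in V1 -> neighborhood v = V2) ->
    aleph (induced V2) ->
    aleph G.

(* Main.v *)
(* [K_1 \cup P_2]-freeness says exactly that non-adjacency is an equivalence
   relation, so [G] is complete multipartite; peeling off one part at a time
   puts [G] in [aleph].  If moreover no part has more than [n/2] vertices, order
   the vertices cyclically with as few non-adjacent consecutive pairs as
   possible.  If the consecutive vertices [u], [v] are non-adjacent, they lie in
   one part [A]; as [#|A| <= n/2], some two consecutive vertices [a], [y] lie
   outside [A].  Replacing the pairs [uv], [ay] by [au], [yv] (a 2-opt move)
   creates two edges, contradicting minimality; so the order is a Hamilton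
   cycle. *)
Require Import Defs.
From mathcomp Require Import all_boot zify.

Set Implicit Arguments.
Unset Strict Implicit.
Unset Printing Implicit Defensive.

Section Defects.
Variables (T : Type) (e : rel T).

Definition defects (x : T) (s : seq T) : nat :=
  sumn (pairmap (fun a b => ~~ e a b : nat) x s).

Definition cycle_defects (s : seq T) : nat :=
  if s is x :: p then defects x (rcons p x) else 0.

Lemma defects_cons x y s : defects x (y :: s) = ~~ e x y + defects y s.
Proof. by []. Qed.

Lemma defects_cat x s1 s2 :
  defects x (s1 ++ s2) = defects x s1 + defects (last x s1) s2.
Proof. by rewrite /defects pairmap_cat sumn_cat. Qed.

Lemma defects_rcons x s y :
  defects x (rcons s y) = defects x s + ~~ e (last x s) y.
Proof. by rewrite -cats1 defects_cat defects_cons addn0. Qed.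

Lemma path_defects x s : path e x s = (defects x s == 0).
Proof.
by elim: s x => //= y s IHs x; rewrite defects_cons addn_eq0 eqb0 negbK IHs.
Qed.

Lemma cycle_defects_eq0 s : cycle e s = (cycle_defects s == 0).
Proof. by case: s => //= x p; rewrite path_defects. Qed.

Lemma cycle_defectsC s1 s2 : cycle_defects (s1 ++ s2) = cycle_defects (s2 ++ s1).
Proof.
case: s1 s2 => [|x p] [|y q] //; rewrite ?cats0 //=.
rewrite !rcons_cat !rcons_cons !defects_cat !defects_cons !defects_rcons; lia.
Qed.

Lemma last_rev_belast (x : T) s : last (last x s) (rev (belast x s)) = x.
Proof. by case: s => //= y s; rewrite rev_cons last_rcons. Qed.

(** [last x s :: rev (belast x s)] is the reversal of [x :: s]; symmetry lets each consecutive pair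
    be read backwards. *)
Lemma defects_rev x s :
  symmetric e -> defects (last x s) (rev (belast x s)) = defects x s.
Proof.
move=> e_sym; elim: s x => //= y s IHs x.
by rewrite rev_cons defects_rcons IHs last_rev_belast e_sym defects_cons addnC.
Qed.

Lemma pathPn x s :
  ~~ path e x s -> exists s1 y s2, s = s1 ++ y :: s2 /\ ~~ e (last x s1) y.
Proof.
elim: s x => //= y s IHs x; rewrite negb_and => /orP[nexy|/IHs].
  by exists [::], y, s.
by move=> [s1 [z [s2 [-> ?]]]]; exists (y :: s1), z, s2.
Qed.

(** Rotating the cycle moves a bad pair to the closing position, so that the 2-opt move becomes the
    reversal of a suffix. *)
Lemma cyclePn s : ~~ cycle e s ->
  exists v q s1 s2, [/\ s = s1 ++ s2, s2 ++ s1 = v :: q & ~~ e (last v q) v].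
Proof.
case: s => //= x p /pathPn[s1 [y [s2 []]]].
(* An empty [s2] means that the bad pair already closes the cycle; otherwise the rotation starts at
   [y]. *)
case/lastP: s2 => [|s2 z].
  by rewrite cats1 => /rcons_inj[-> ->]; exists y, s1, [::], (y :: s1); rewrite cats0.
rewrite -rcons_cons -rcons_cat => /rcons_inj[-> ->] nezy.
by exists y, (s2 ++ z :: s1), (z :: s1), (y :: s2); rewrite last_cat.
Qed.

End Defects.

(** Entries outside [A] are separated by entries of [A], so they exceed these by at most one, and
    each end lying in [A] lowers the bound by one. *)
Lemma count_alternating (T : Type) (A : pred T) x s :
  path (fun a b => A a || A b) x s ->
  count (predC A) (x :: s) + A x + A (last x s) <= (count A (x :: s)).+1.
Proof.
elim: s x => [|y s IHs] x /=; first by case: (A x).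
case/andP=> Axy /IHs /=; move: Axy; case: (A x); case: (A y) => //= _; lia.
Qed.

Section Multipartite.
Variable G : sgraph.

(** Non-adjacency is always reflexive and symmetric, so transitivity makes it an equivalence. The
    part of [v] is [~: neighborhood v]. *)
Definition multipartite : Prop :=
  forall x y z : G, ~~ adj x y -> ~~ adj y z -> ~~ adj x z.

Lemma free_multipartite :
  free_of (disjoint_union (complete_graph 1) (path_graph 2)) G -> multipartite.
Proof.
move=> G_free x y z nxy nyz; apply/negP=> xz.
have neq_yx : (y == x) = false by apply: contraNF nyz => /eqP->.
have neq_yz : (y == z) = false by apply: contraNF nxy => /eqP->.
have neq_xz : (x == z) = false by apply: contraTF xz => /eqP->; rewrite adj_irrefl.
apply: (G_free [set x; y; z]).
(* [y] plays the isolated vertex, [x] and [z] the ends of the edge. *)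
pose f (w : induced [set x; y; z]) :
    disjoint_union (complete_graph 1) (path_graph 2) :=
  if val w == y then inl ord0 else
  if val w == x then inr ord0 else inr (inord 1).
have memE (w : induced [set x; y; z]) : [\/ val w = x, val w = y | val w = z].
  have := valP w; rewrite !inE => /orP[/orP[]|] /eqP->;
    by [constructor 1 | constructor 2 | constructor 3].
have eqs := (eq_sym x y, eq_sym z y, eq_sym z x, neq_yx, neq_yz, neq_xz, eqxx).
exists f; split.
  apply: inj_card_bij.
    move=> a b; rewrite /f => fab; apply: val_inj; move: fab.
    case: (memE a) => ->; case: (memE b) => ->; rewrite ?eqs //;
      by case=> /(congr1 val) /=; rewrite inordK.
  by rewrite card_sum !card_ord card_sig -setUA cardsU1 cards2 !inE ?eqs.
have nonedges := (adj_irrefl, negPf nxy, negPf nyz).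
move=> a b; change (adj (f a) (f b) = adj (\val a) (\val b)); rewrite /f.
case: (memE a) => ->; case: (memE b) => ->.
all: rewrite ?eqs /= /complete_adj /path_adj /= ?inordK ?nonedges ?xz //.
all: by rewrite adj_sym ?nonedges ?xz.
Qed.

Hypothesis G_mult : multipartite.

Lemma independent_nonneighbors (v : G) : independent (~: neighborhood v).
Proof.
apply/forall_inP=> x; rewrite !inE => nvx; apply/forall_inP=> y.
by rewrite !inE; apply: G_mult; rewrite adj_sym.
Qed.

Lemma neighborhood_nonadj (u v : G) :
  ~~ adj u v -> neighborhood u = neighborhood v.
Proof.
move=> nuv; apply/setP=> x; rewrite !inE; apply: negb_inj.
by apply/idP/idP; apply: G_mult; rewrite // adj_sym.
Qed.

Lemma nonneighbors_le (v : G) : #|~: neighborhood v| <= independence_number G.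
Proof.
by rewrite /independence_number; apply: leq_bigmax_cond;
  apply: independent_nonneighbors.
Qed.

Lemma two_opt (v : G) q :
    2 * #|~: neighborhood v| <= #|G| -> perm_eq (v :: q) (enum G) ->
    ~~ adj (last v q) v ->
  exists2 s, perm_eq s (enum G) &
    cycle_defects (@adj G) s < cycle_defects (@adj G) (v :: q).
Proof.
move=> part_le vq_enum nuv; pose A : pred G := fun x => ~~ adj v x.
have count_A : count A (enum G) = #|~: neighborhood v|.
  rewrite -sum1_card -sum1_count big_enum_cond /=.
  by apply: eq_bigl => x; rewrite /A !inE.
(* Both ends [v] and [last v q] lie in [A], so alternation would force [2 * #|A| > #|G|]. *)
have nalt : ~~ path (fun a b => A a || A b) v q.
  apply/negP=> alt; have := count_alternating alt.
  have := count_predC A (enum G); rewrite -cardT.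
  rewrite !(seq.permP vq_enum) count_A; move: (count _ _) => c.
  rewrite /A adj_irrefl [adj v _]adj_sym nuv; lia.
have [s1 [y [s2 [q_def]]]] := pathPn nalt.
rewrite /A negb_or !negbK => /andP[va vy].
have nadj_u x : adj v x -> adj (last v q) x.
  by have /setP/(_ x) := neighborhood_nonadj nuv; rewrite !inE => ->.
have last_q : last v q = last y s2 by rewrite q_def last_cat.
(* The pairs joining [last v s1] to [y] and [last v q] to [v] give way to [last v s1] with
   [last v q], and [y] with [v]. Both new pairs are edges, since [last v q] has the same neighbors
   as [v]; the old closing pair was a defect. *)
exists (v :: s1 ++ rev (y :: s2)).
  rewrite -(permPr vq_enum) q_def perm_cons perm_cat2l perm_rev //.
rewrite q_def /= !rcons_cat (lastI y s2) rev_rcons !rcons_cons -lastI !defects_cat.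
rewrite !defects_cons !defects_rcons last_rev_belast (defects_rev _ _ (@adj_sym G)) -last_q nuv.
rewrite [adj (last v s1) _]adj_sym nadj_u // adj_sym vy /=; lia.
Qed.

(** For one vertex the bound fails, so $K_1$ falls under the other alternative of the theorem. *)
Lemma multipartite_hamiltonian :
  0 < #|G| -> 2 * independence_number G <= #|G| -> hamiltonian G.
Proof.
move=> G_gt0 alpha_le.
have part_le (v : G) : 2 * #|~: neighborhood v| <= #|G|.
  by apply: leq_trans alpha_le; apply: leq_mul => //; apply: nonneighbors_le.
suff [s s_enum s0] : exists2 s : seq G, perm_eq s (enum G) & cycle (@adj G) s.
  have size_s : size s = #|G| by rewrite (perm_size s_enum) -cardT.
  exists s => //; rewrite /graph_cycle /ucycleb s0 (perm_uniq s_enum) enum_uniq.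
  by rewrite -size_eq0 size_s -lt0n G_gt0 orbT.
have [m] := ubnP (cycle_defects (@adj G) (enum G)).
have := perm_refl (enum G).
(* Descent on the number of defects: only the current ordering is generalized, the reference
   enumeration stays fixed. *)
elim: m {1 3}(enum G) => // m IHm s s_enum s_lt.
have [s_cyc|/cyclePn[v [q [s1 [s2 [s_def vq_def nuv]]]]]] :=
  boolP (cycle (@adj G) s); first by exists s.
have vq_enum : perm_eq (v :: q) (enum G).
  by rewrite -vq_def perm_catC -s_def.
have [t t_enum t_lt] := two_opt (part_le v) vq_enum nuv.
apply: (IHm t t_enum); apply: leq_trans t_lt _.
by rewrite -vq_def cycle_defectsC -s_def.
Qed.

End Multipartite.

Lemma multipartite_induced (G : sgraph) (S : {set G}) :
  multipartite G -> multipartite (induced S).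
Proof. by move=> G_mult x y z; apply: G_mult. Qed.

Lemma multipartite_aleph (G : sgraph) : multipartite G -> aleph G.
Proof.
have [m] := ubnP #|G|; elim: m G => // m IHm G G_lt G_mult.
have [|] := boolP (independent [set: G]); first exact: aleph_independent.
case/forall_inPn=> v _ /forall_inPn[w _]; rewrite negbK => vw.
have v_part : v \in ~: neighborhood v by rewrite !inE adj_irrefl.
(* The part of [v] is peeled off; the edge [vw] keeps the rest nonempty, and [v] itself is missing
   from the rest, so the order drops. *)
apply: (@aleph_join G (~: neighborhood v) (neighborhood v)).
- by rewrite setUC setUCr.
- by rewrite -setI_eq0 setIC setICr.
- by apply/set0Pn; exists v.
- by apply/set0Pn; exists w; rewrite inE.
- exact: independent_nonneighbors.
- by move=> u; rewrite !inE adj_sym => /(neighborhood_nonadj G_mult).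
apply: IHm; last exact: multipartite_induced.
rewrite card_sig; apply: leq_trans (_ : #|neighborhood v| < m) => //.
rewrite -ltnS; apply: leq_ltn_trans G_lt.
rewrite -[#|G|](cardsC (neighborhood v)) -addn1 leq_add2l.
by apply/card_gt0P; exists v.
Qed.

Theorem theorem1 (G : sgraph) (n : nat) (order_G : #|G| = n) (n_gt0 : 0 < n)
    (G_free : free_of (disjoint_union (complete_graph 1) (path_graph 2)) G) :
  hamiltonian G \/ (aleph G /\ n < 2 * independence_number G).
Proof.
have G_mult := free_multipartite G_free; subst n.
have [alpha_le|alpha_gt] := leqP (2 * independence_number G) #|G|.
  by left; apply: multipartite_hamiltonian.
by right; split; first exact: multipartite_aleph.
Qed.
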